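(* Let $p$ be a prime, $r\ge 1$, $q=p^r$, and $m$ a positive integer divisible by $r$. Let $\hat{C}$ be an extended maximal affine-invariant code over $\mathbb{F}_q$ with parameters $[p^m,\,p^m-1-\frac{m}{r},\,d]$. If $p>3$ or $m>2$ or $r\ne 1$, then $\hat{C}^{\perp}\subset\hat{C}$.
   Context: Let $n=p^m-1$ and let $\beta$ be a fixed primitive $n$-th root of unity in $G=\mathbb{F}_{p^m}$. A cyclic code $C$ of length $n$ over $\mathbb{F}_q$ is an ideal of $\mathbb{F}_q[x]/(x^n-1)$ generated by a polynomial $g(x)$ dividing $x^n-1$; its defining set is $T=\{0\le i\le n-1 : g(\beta^i)=0\}$, a union of cyclotomic classes $Cl(j)=\{jq^l \bmod n : l\in\mathbb{Z}\}$. $C$ is a maximal cyclic code if $T$ consists of exactly one cyclotomic class. The extended code of $C$ is $\hat{C}=\{(x_0,x_1,\dots,x_n) : (x_1,\dots,x_n)\in C,\ x_0=-\sum_{i=1}^n x_i\}$, of length $p^m$, with coordinates labelled by the elements of $G$: $x_0$ is labelled by $0\in G$, and the coordinate of $C$ that is the coefficient of $x^i$ is labelled by $\beta^i$. $\hat{C}$ is affine-invariant if it is invariant under all coordinate permutations induced by the maps $X\mapsto aX+b$ of $G$, with $a\in G\setminus\{0\}$, $b\in G$. An extended maximal affine-invariant code is an affine-invariant code of the form $\hat{C}$ with $C$ a maximal cyclic code. $\perp$ denotes the Euclidean dual over $\mathbb{F}_q$, and $\subset$ allows equality. *)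

(* Defs.v *)
From HB Require Import structures.
From mathcomp Require Import all_boot all_order all_fingroup all_algebra.
From mathcomp Require Import qpoly sesquilinear.

Set Implicit Arguments.
Unset Strict Implicit.
Unset Printing Implicit Defensive.

Import GRing.Theory.
Local Open Scope ring_scope.

(* Linear codes of length N over F are subspaces of 'rV[F]_N. *)

Section LinearCodes.
Variables (F : finFieldType) (N : nat).
Implicit Types (u v : 'rV[F]_N) (C : {vspace 'rV[F]_N}).

Definition edot u v : F := (u *m v^T) 0 0.

Fact edot_linearl v : scalar (edot^~ v).
Proof. by move=> a u w; rewrite /edot mulmxDl -scalemxAl !mxE. Qed.

Fact edot_linearr u : scalar (edot u).
Proof.
by move=> a v w; rewrite /edot linearP /= mulmxDr -scalemxAr !mxE.
Qed.

HB.instance Definition _ :=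
  bilinear_isBilinear.Build F 'rV[F]_N 'rV[F]_N F *%R *%R edot
    (edot_linearl, edot_linearr).

Fact edot_sym u v : edot u v = (-1) ^+ false * idfun (edot v u).
Proof.
by rewrite mul1r /edot -trace_mx11 -mxtrace_tr trmx_mul trmxK trace_mx11.
Qed.

HB.instance Definition _ :=
  isHermitianSesquilinear.Build F 'rV[F]_N false idfun edot edot_sym.

Definition dual_code C : {vspace 'rV[F]_N} :=
  orthov (edot : {symmetric 'rV[F]_N}) C.

Definition hamming_dist u v : nat := #|[set i | u 0 i != v 0 i]|.

Definition min_distance C (d : nat) : Prop :=
  (exists u v, [/\ u \in C, v \in C, u != v & hamming_dist u v = d]) /\
  (forall u v, u \in C -> v \in C -> u != v -> (d <= hamming_dist u v)%N).

Definition code_parameters C (len k d : nat) : Prop :=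
  [/\ N = len, \dim C = k & min_distance C d].

End LinearCodes.

(* The exponent of q ranges over all integers: the second disjunct is
   i = j q^(-l), q being invertible modulo n. *)
Definition in_cyclotomic_class (q n j i : nat) : Prop :=
  exists l : nat, i = j * q ^ l %[mod n] \/ i * q ^ l = j %[mod n].

Section CyclicCodes.
Variables (F G : finFieldType) (iota : {rmorphism F -> G}) (n : nat).
Variable beta : G.
Implicit Types (g : {poly F}) (C : {vspace 'rV[F]_n}).

(* Coordinate i of a word is the coefficient of 'X^i. *)
Definition word_qpoly (c : 'rV[F]_n) : {poly %/ 'X^n - 1 : {poly F}} :=
  in_qpoly ('X^n - 1) (rVpoly c).

Definition cyclic_code g C : Prop :=
  g %| 'X^n - 1 /\
  (forall c, c \in C <->
     exists a : {poly %/ 'X^n - 1 : {poly F}},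
       word_qpoly c = a * in_qpoly ('X^n - 1) g).

Definition defining_set g : {set 'I_n} :=
  [set i : 'I_n | root (map_poly iota g) (beta ^+ i)].

Definition maximal_cyclic_code C : Prop :=
  exists2 g, cyclic_code g C &
    exists j : 'I_n, forall i : 'I_n,
      i \in defining_set g <-> in_cyclotomic_class #|F| n j i.

(* The words (x_0, x_1, ..., x_n): index ord0 carries x_0, and index
   lift ord0 i, i.e. i + 1, carries the coefficient of 'X^i. *)
Definition extend (c : 'rV[F]_n) : 'rV[F]_n.+1 :=
  \row_k (if unlift ord0 k is Some i then c 0 i else - \sum_i c 0 i).

Fact extend_is_linear : linear extend.
Proof.
move=> a u v; apply/rowP => k; rewrite !mxE.
case: unliftP => [i _|_]; rewrite ?mxE //.
under eq_bigr do rewrite !mxE.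
by rewrite big_split /= -mulr_sumr opprD mulrN.
Qed.

HB.instance Definition _ :=
  GRing.isLinear.Build F 'rV[F]_n 'rV[F]_n.+1 _ extend extend_is_linear.

Definition extended_code C : {vspace 'rV[F]_n.+1} := (linfun extend @: C)%VS.

Definition label (k : 'I_n.+1) : G :=
  if unlift ord0 k is Some i then beta ^+ i else 0.

(* When beta is a primitive n-th root of unity and #|G| = n + 1, label is a
   bijection, so each map X |-> a X + b induces exactly one permutation s. *)
Definition affine_invariant (E : {vspace 'rV[F]_n.+1}) : Prop :=
  forall (a b : G) (s : 'S_n.+1), a != 0 ->
    (forall k, label (s k) = a * label k + b) ->
    forall c, c \in E -> col_perm s c \in E.

Definition extended_maximal_affine_invariant (E : {vspace 'rV[F]_n.+1}) : Prop :=
  exists C, [/\ maximal_cyclic_code C, E = extended_code C & affine_invariant E].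

End CyclicCodes.

(* Main.v *)
(* For a word x indexed by the elements of G put V_x(t) = sum_y x(y) y^t. If j
   is in the defining set T and p^a is the p-part of j, invariance of the
   extended code under y |-> b y + 1 makes a polynomial of degree at most
   j / p^a vanish on all of G; its linear coefficient shows that p^a is in T,
   so T = Cl(p^a). If v is orthogonal to the extended code, invariance under
   y |-> b y gives V_v(t) V_c(n - t) = 0 for all codewords c and 0 < t < n.
   As p^m - 1 never divides 1 + q^l under the hypothesis on p, m and r, the
   exponent -p^a is not in T, hence V_c(n - p^a) <> 0 for the generator c, so
   V_v(p^a) = 0 and, by Frobenius, V_v vanishes on T. Finally v sums to 0
   because the all-ones word is in the code. *)
Require Import Defs.
From HB Require Import structures.
From mathcomp Require Import all_boot all_order all_fingroup all_algebra all_field.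
From mathcomp Require Import qpoly sesquilinear zify.

Set Implicit Arguments.
Unset Strict Implicit.
Unset Printing Implicit Defensive.

Import GRing.Theory.
Local Open Scope ring_scope.

(** * Exponents and cyclotomic classes modulo [n] *)

Lemma eq_expr_mod_gt0 (K : finFieldType) (n s t : nat) (y : K) :
  #|K| = n.+1 -> (0 < s)%N -> (0 < t)%N -> s = t %[mod n] -> y ^+ s = y ^+ t.
Proof.
(* Since [0 ^+ 0 = 1], it is the positivity of both exponents that makes the powers agree at
   [y = 0]. *)
move=> cardK s_gt0 t_gt0 st; have [->|y_neq0] := eqVneq y 0.
  by rewrite !expr0n !eqn0Ngt s_gt0 t_gt0.
have yn1 : y ^+ n = 1.
  by apply: (mulfI y_neq0); rewrite -exprS -cardK expf_card mulr1.
by rewrite -(expr_mod s yn1) st expr_mod.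
Qed.

Lemma edotE (F : finFieldType) (N : nat) (u v : 'rV[F]_N) :
  edot u v = \sum_k u 0 k * v 0 k.
Proof. by rewrite /edot mxE; apply: eq_bigr => k _; rewrite mxE. Qed.

Lemma in_cyclotomic_class_periodic (q n k j i : nat) :
  (0 < k)%N -> q ^ k = 1 %[mod n] -> in_cyclotomic_class q n j i ->
  exists l, i = j * q ^ l %[mod n].
Proof.
move=> k_gt0 qk1 [l [ijq|iqj]]; first by exists l.
(* As [q ^ k = 1], the inverse of [q ^ l] is [q ^ (l * (k - 1))]. *)
exists (l * k.-1)%N.
rewrite -modnMml -iqj modnMml -mulnA -expnD -mulnS prednK //.
have qkl1 : (q ^ k) ^ l = 1 %[mod n] by rewrite -modnXm qk1 modnXm exp1n.
by rewrite (mulnC l k) expnM -modnMmr qkl1 modnMmr muln1.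
Qed.

Lemma in_qpolyK (A : comNzRingType) (h : {poly A}) (a : {poly %/ h}) :
  in_qpoly h a = a.
Proof. by apply: val_inj; apply: in_qpoly_small; apply: size_mk_monic. Qed.

Section ExtendedCyclicCodes.
Variables (F G : finFieldType) (iota : {rmorphism F -> G}) (n : nat) (beta : G).
Hypotheses (beta_prim : n.-primitive_root beta) (cardG : #|G| = n.+1).
Implicit Types (g : {poly F}) (C : {vspace 'rV[F]_n}) (w : 'rV[F]_n).
Implicit Types (E : {vspace 'rV[F]_n.+1}) (v c x : 'rV[F]_n.+1).

Notation lab := (@label G n beta).
Notation "p ^G" := (map_poly iota p) (at level 2, format "p ^G").

Let n_gt0 : (0 < n)%N := prim_order_gt0 beta_prim.

Let beta_neq0 : beta != 0.
Proof. by rewrite (prim_root_eq0 beta_prim) -lt0n. Qed.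

(** * Labels in [G], affine permutations and power sums *)

Lemma label0 : lab ord0 = 0.
Proof. by rewrite /label unlift_none. Qed.

Lemma label_lift i : lab (lift ord0 i) = beta ^+ i.
Proof. by rewrite /label liftK. Qed.

Lemma label_inj : injective lab.
Proof.
move=> k1 k2; rewrite /label.
case: unliftP => [i1 ->|->]; case: unliftP => [i2 ->|->] //.
- move/eqP; rewrite (eq_prim_root_expr beta_prim) !modn_small // => /eqP.
  by move/val_inj->.
- by move/eqP; rewrite expf_eq0 (negPf beta_neq0) andbF.
- by move/esym/eqP; rewrite expf_eq0 (negPf beta_neq0) andbF.
Qed.

Lemma label_bij : bijective lab.
Proof. by apply: inj_card_bij label_inj _; rewrite cardG card_ord. Qed.

Lemma affine_perm (a b : G) :
  a != 0 -> exists s : 'S_n.+1, forall k, lab (s k) = a * lab k + b.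
Proof.
move=> a_neq0; have [unlab labK unlabK] := label_bij.
have s_inj : injective (fun k => unlab (a * lab k + b)).
  move=> k1 k2 /(can_inj unlabK)/addIr/(mulfI a_neq0); exact: label_inj.
by exists (perm s_inj) => k; rewrite permE unlabK.
Qed.

(** This is V_x(s), the Mattson-Solomon transform of [x]. As [0 ^+ 0 = 1], the coordinate labelled 0
    contributes only at [s = 0]. *)
Definition power_sum x s : G := \sum_k iota (x 0 k) * lab k ^+ s.

Lemma eq_power_sum x s t : (0 < s)%N -> (0 < t)%N -> s = t %[mod n] ->
  power_sum x s = power_sum x t.
Proof.
move=> s_gt0 t_gt0 st; apply: eq_bigr => k _.
by rewrite (eq_expr_mod_gt0 _ cardG s_gt0 t_gt0 st).
Qed.

Lemma power_sum_extend w s :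
  (0 < s)%N -> power_sum (extend w) s = (rVpoly w)^G.[beta ^+ s].
Proof.
move=> s_gt0; rewrite /power_sum big_ord_recl label0 expr0n eqn0Ngt s_gt0 mulr0.
rewrite add0r (@horner_coef_wide _ n) ?size_map_poly ?size_poly //.
apply: eq_bigr => i _; rewrite label_lift mxE liftK coef_map coef_rVpoly_ord.
by rewrite exprAC.
Qed.

Lemma sum_extend w : \sum_k extend w 0 k = 0.
Proof.
rewrite big_ord_recl mxE unlift_none; under [X in _ + X]eq_bigr do rewrite mxE liftK.
by rewrite addNr.
Qed.

Lemma extend_surj x : \sum_k x 0 k = 0 ->
  extend (\row_i x 0 (lift ord0 i)) = x.
Proof.
rewrite big_ord_recl => /eqP; rewrite addr_eq0 => /eqP x0; apply/rowP => k.
rewrite mxE; case: unliftP => [i ->|->]; rewrite ?mxE //.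
by rewrite x0; under eq_bigr do rewrite mxE.
Qed.

Lemma mem_extended_code C w : w \in C -> extend w \in extended_code C.
Proof. by move=> wC; rewrite -[extend w]lfunE memv_img. Qed.

Lemma extended_codeP C x :
  x \in extended_code C -> exists2 w, w \in C & x = extend w.
Proof. by case/memv_imgP => w wC ->; exists w; rewrite ?lfunE. Qed.

(** * Cyclic codes through their values at powers of [beta] *)

Let mk_monic_XnsubC : mk_monic ('X^n - 1 : {poly F}) = 'X^n - 1.
Proof. by rewrite /mk_monic size_XnsubC // monicXnsubC // ltnS n_gt0. Qed.

Lemma horner_in_qpoly (p : {poly F}) s :
  (in_qpoly ('X^n - 1) p : {poly F})^G.[beta ^+ s] = p^G.[beta ^+ s].
Proof.
have h0 : (mk_monic ('X^n - 1 : {poly F}))^G.[beta ^+ s] = 0.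
  rewrite mk_monic_XnsubC rmorphB rmorph1 /= map_polyXn !hornerE.
  by rewrite exprAC (prim_expr_order beta_prim) expr1n subrr.
rewrite [p in RHS](Pdiv.RingMonic.rdivp_eq (monic_mk_monic ('X^n - 1))).
by rewrite rmorphD rmorphM hornerD hornerM h0 mulr0 add0r.
Qed.

Lemma horner_word_qpoly w s :
  (word_qpoly w : {poly F})^G.[beta ^+ s] = (rVpoly w)^G.[beta ^+ s].
Proof. exact: horner_in_qpoly. Qed.

Lemma cyclic_code_root g C w s : cyclic_code g C -> w \in C ->
  root g^G (beta ^+ s) -> root (rVpoly w)^G (beta ^+ s).
Proof.
move=> [_ defC] /defC[a wE] /rootP g0; apply/rootP.
rewrite -horner_word_qpoly wE.
by rewrite -[a]in_qpolyK -in_qpolyM horner_in_qpoly rmorphM hornerM g0 mulr0.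
Qed.

(** [g] need not fit in [n] coefficients, as when it is ['X^n - 1], so its residue serves as the
    codeword. *)
Lemma cyclic_code_generator g C : cyclic_code g C ->
  exists2 w, w \in C & forall s, (rVpoly w)^G.[beta ^+ s] = g^G.[beta ^+ s].
Proof.
move=> [_ defC]; set gq := in_qpoly ('X^n - 1) g.
have gqK : rVpoly (poly_rV gq : 'rV_n) = gq.
  apply: poly_rV_K; rewrite -ltnS; apply: leq_trans (size_mk_monic gq) _.
  by rewrite mk_monic_XnsubC size_XnsubC.
exists (poly_rV gq) => [|s]; last by rewrite gqK horner_in_qpoly.
apply/defC; exists 1; rewrite mul1r /word_qpoly gqK.
exact: in_qpolyK.
Qed.

(** Over [G], ['X^n - 1] splits into distinct factors ['X - beta ^+ i], so [g] is, up to a unit, the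
    product of those selected by a mask. Vanishing at these roots gives divisibility over [G], which
    descends to [F]. *)
Lemma mem_cyclic_code g C w : cyclic_code g C ->
  (forall i : 'I_n, i \in defining_set iota n beta g ->
     root (rVpoly w)^G (beta ^+ i)) ->
  w \in C.
Proof.
move=> [g_dvd defC] w0.
suff /dvdpP[a aE] : g %| rVpoly w.
  apply/defC; exists (in_qpoly ('X^n - 1) a).
  by rewrite /word_qpoly aE in_qpolyM.
rewrite -(dvdp_map iota).
have := g_dvd; rewrite -(dvdp_map iota) rmorphB rmorph1 /= map_polyXn.
rewrite -(factor_Xn_sub_1 beta_prim) => /dvdp_prod_XsubC[m g_eqp].
rewrite (eqp_dvdl _ g_eqp) -(big_map (GRing.exp beta) xpredT (fun z => 'X - z%:P)).
have m_lt i : i \in mask m (index_iota 0 n) -> (i < n)%N.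
  by move/mem_mask; rewrite mem_index_iota.
apply: uniq_roots_dvdp.
  apply/allP => _ /mapP[i i_m ->].
  apply: (w0 (Ordinal (m_lt i i_m))); rewrite inE /= (eqp_root g_eqp).
  by rewrite -(big_map (GRing.exp beta) xpredT (fun z => 'X - z%:P)) root_prod_XsubC map_f.
rewrite uniq_rootsE map_inj_in_uniq ?mask_uniq ?iota_uniq // => i j /m_lt i_n /m_lt j_n.
by move/eqP; rewrite (eq_prim_root_expr beta_prim) !modn_small // => /eqP.
Qed.

(** Since [g] does not vanish at 1, the defining set has only positive exponents; power sums there
    ignore the coordinate labelled 0 and are values of the punctured word. *)
Lemma mem_extended_code_power_sum g C x : cyclic_code g C ->
  ~~ root g^G 1 -> \sum_k x 0 k = 0 ->
  (forall i : 'I_n, i \in defining_set iota n beta g -> power_sum x i = 0) ->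
  x \in extended_code C.
Proof.
move=> cycC g1 x_sum x0; rewrite -(extend_surj x_sum).
apply/mem_extended_code/(mem_cyclic_code cycC) => i iT.
have i_gt0 : (0 < i)%N.
  rewrite lt0n; apply: contraNneq g1 => i0.
  by move: iT; rewrite inE i0 expr0.
by apply/rootP; rewrite -power_sum_extend // extend_surj // x0.
Qed.

(** * Consequences of affine invariance for power sums *)

Lemma col_perm_affine_sum c (s : 'S_n.+1) (a b : G) t :
  a != 0 -> (forall k, lab (s k) = a^-1 * lab k - a^-1 * b) ->
  power_sum (col_perm s c) t = \sum_k iota (c 0 k) * (a * lab k + b) ^+ t.
Proof.
(* [col_perm s c] reads [c] at [s k], so [s] must induce the inverse of X -> aX + b for the labels
   to be substituted by that map. *)
move=> a_neq0 sE; rewrite [RHS](reindex_inj (@perm_inj _ s)).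
apply: eq_bigr => k _; rewrite mxE sE -mulrBr mulrA divff // mul1r.
by rewrite subrK.
Qed.

Lemma affine_invariant_power_sum E c (a b : G) :
  affine_invariant beta E -> c \in E -> a != 0 ->
  exists2 c', c' \in E &
    forall t, power_sum c' t = \sum_k iota (c 0 k) * (a * lab k + b) ^+ t.
Proof.
move=> affE cE a_neq0; have ai_neq0 : a^-1 != 0 by rewrite invr_eq0.
have [s sE] := affine_perm (- (a^-1 * b)) ai_neq0.
by exists (col_perm s c) => [|t]; [apply: affE sE _ cE | apply: col_perm_affine_sum].
Qed.

Lemma sum_exprG t : (0 < t < n)%N -> \sum_(y : G) y ^+ t = 0.
Proof.
move=> /andP[t_gt0 t_n]; set S := \sum_y _.
(* Scaling the variable by [beta] permutes [G], and [beta ^+ t] differs from 1. *)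
have SE : S = beta ^+ t * S.
  rewrite {1}/S (reindex_inj (mulfI beta_neq0)) mulr_sumr.
  by apply: eq_bigr => y _; rewrite exprMn.
apply/eqP; have /eqP : (beta ^+ t - 1) * S = 0 by rewrite mulrBl mul1r -SE subrr.
rewrite mulf_eq0 subr_eq0 -(prim_order_dvd beta_prim) => /orP[|//].
by move/(dvdn_leq t_gt0); rewrite leqNgt t_n.
Qed.

(* Summing the relations [v, c(a X)] = 0 against a^(n-s) over all a in G
   turns orthogonality to the orbit of c into a product of power sums. *)
Lemma power_sum_dual E v c s :
  affine_invariant beta E -> v \in dual_code E -> c \in E -> (0 < s < n)%N ->
  power_sum v s * power_sum c (n - s) = 0.
Proof.
move=> affE /mem_orthovP vE cE /andP[s_gt0 s_n].
have [unlab labK unlabK] := label_bij; set t := (n - s)%N.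
have t_gt0 : (0 < t)%N by rewrite subn_gt0.
have t_n : (t < n)%N by rewrite ltn_subrL s_gt0 n_gt0.
(* For y = [lab k] nonzero, replace a by a / y and use y^(-t) = y^s; for y = 0 both sides vanish. *)
have inner k : \sum_(a : G) a ^+ t * iota (c 0 (unlab (a * lab k)))
    = lab k ^+ s * power_sum c t.
  have [->|y_neq0] := eqVneq (lab k) 0.
    under eq_bigr do rewrite mulr0.
    by rewrite -mulr_suml sum_exprG ?t_gt0 // expr0n eqn0Ngt s_gt0 !mul0r.
  have yV : (lab k)^-1 ^+ t = lab k ^+ s.
    apply: (mulIf (expf_neq0 t y_neq0)); rewrite -exprMn mulVf // expr1n.
    rewrite -exprD subnKC ?(ltnW s_n) //; apply: (mulfI y_neq0).
    by rewrite -exprS -cardG expf_card mulr1.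
  rewrite (reindex_inj (mulIf (invr_neq0 y_neq0))).
  under eq_bigr do rewrite mulfVK //.
  rewrite (reindex lab) /=; last exact/onW_bij/label_bij.
  rewrite mulr_sumr; apply: eq_bigr => i _; rewrite labK.
  by rewrite exprMn yV mulrAC mulrC [_ * iota _]mulrC.
rewrite mulr_suml.
under eq_bigr do rewrite -mulrA -inner mulr_sumr.
(* [a = 0] induces no permutation, but its term carries the factor [0 ^+ t] with [t] positive. *)
rewrite exchange_big big1 // => a _; have [->|a_neq0] := eqVneq a 0.
  by rewrite big1 // => k _; rewrite expr0n eqn0Ngt t_gt0 mul0r mulr0.
have [sg sgE] := affine_perm 0 a_neq0.
have vc0 : \sum_k v 0 k * col_perm sg c 0 k = 0.
  by rewrite -edotE; apply/vE/(affE _ _ _ a_neq0 sgE _ cE).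
transitivity (a ^+ t * iota (\sum_k v 0 k * col_perm sg c 0 k)); last first.
  by rewrite vc0 rmorph0 mulr0.
rewrite rmorph_sum mulr_sumr.
apply: eq_bigr => k _; rewrite mulrCA rmorphM mxE; congr (_ * (_ * _)).
by congr (iota (c 0 _)); rewrite -[sg k]labK sgE addr0.
Qed.

Lemma power_sum_ppart p a j E :
  p \in [pchar G] -> (j%:R != 0 :> G) -> (p ^ a * j <= n)%N ->
  affine_invariant beta E -> (forall c, c \in E -> \sum_k c 0 k = 0) ->
  (forall c, c \in E -> power_sum c (p ^ a * j) = 0) ->
  forall c, c \in E -> power_sum c (p ^ a) = 0.
Proof.
move=> pG j_neq0 le_n affE sumE0 E0 c cE; set Q := (p ^ a)%N.
have pQ : [pchar G].-nat Q by rewrite pnatX pnatE ?(pcharf_prime pG) // pG.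
have Q_gt0 : (0 < Q)%N by rewrite expn_gt0 prime_gt0 // (pcharf_prime pG).
have j_gt0 : (0 < j)%N by rewrite lt0n; apply: contra_neq j_neq0 => ->.
(* By Frobenius, (yx + 1)^(Qj) = (1 + x^Q y^Q)^j; [P] is the weighted sum of these with ['X] in
   place of y^Q. *)
pose P := \sum_k iota (c 0 k) *: (1 + (lab k ^+ Q) *: 'X) ^+ j.
have P_root (y : G) : P.[y ^+ Q] = 0.
  have PE : P.[y ^+ Q] = \sum_k iota (c 0 k) * (y * lab k + 1) ^+ (Q * j).
    rewrite horner_sum; apply: eq_bigr => k _; rewrite !hornerE; congr (_ * _).
    by rewrite [in RHS]exprM (exprDn_pchar _ _ pQ) expr1n exprMn addrC [in LHS]mulrC.
  rewrite PE; have [->|y_neq0] := eqVneq y 0.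
    under eq_bigr do rewrite mul0r add0r expr1n mulr1.
    by rewrite -rmorph_sum sumE0 // rmorph0.
  by have [c' c'E <-] := affine_invariant_power_sum 1 affE cE y_neq0; apply: E0.
(* Injectivity yields [n + 1] distinct roots y^Q of [P], whose degree is at most [j], hence at most
   [n]. *)
have frob_inj : injective (fun y : G => y ^+ Q).
  move=> y z /eqP; rewrite -subr_eq0 -exprNn_pchar // -exprDn_pchar //.
  by rewrite expf_eq0 Q_gt0 subr_eq0 => /eqP.
have P0 : P = 0.
  apply: (@roots_geq_poly_eq0 _ _ [seq y ^+ Q | y : G]).
  - by apply/allP => _ /imageP[y _ ->]; apply/rootP.
  - by rewrite map_inj_uniq ?enum_uniq.
  - rewrite size_image cardG; apply: leq_trans (size_sum _ _ _) _.
    apply/bigmax_leqP => k _; apply: leq_trans (size_scale_leq _ _) _.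
    have lin_size : (size (1 + lab k ^+ Q *: 'X)%R <= 2)%N.
      apply: leq_trans (size_polyD _ _) _; rewrite geq_max size_poly1 /=.
      by rewrite (leq_trans (size_scale_leq _ _)) ?size_polyX.
    apply: leq_trans (size_poly_exp_leq _ _) _; rewrite ltnS.
    apply: leq_trans le_n; rewrite leq_mul //.
    by apply: leq_trans Q_gt0; case: (size _) lin_size => [|[|[]]].
have /eqP : P^`().[0] = 0 by rewrite P0 deriv0 horner0.
have -> : P^`().[0] = power_sum c Q * j%:R.
  rewrite raddf_sum horner_sum mulr_suml; apply: eq_bigr => k _.
  rewrite /= derivZ deriv_exp !derivE !hornerE hornerMn hornerM horner_exp !hornerE.
  by rewrite expr1n mulr1 mulrnAr mulr_natr.
by rewrite mulf_eq0 (negPf j_neq0) orbF => /eqP.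
Qed.

Lemma power_sum_const1 s : (0 < s < n)%N -> power_sum (const_mx 1) s = 0.
Proof.
move=> s_n; rewrite -[RHS](sum_exprG s_n) [RHS](reindex lab) /=.
  by apply: eq_bigr => k _; rewrite mxE rmorph1 mul1r.
exact/onW_bij/label_bij.
Qed.

(** Raising to the power [#|F| ^ l] is additive on [G] and fixes the coordinates of [x], so it acts
    on the labels alone. *)
Lemma power_sum_frobenius x s l : [pchar G].-nat #|F| ->
  power_sum x (s * #|F| ^ l) = power_sum x s ^+ (#|F| ^ l).
Proof.
move=> qG; have qlG : [pchar G].-nat (#|F| ^ l)%N by rewrite pnatX qG.
have ql_gt0 : (0 < #|F| ^ l)%N by case/andP: qlG.
have fixF (z : F) : z ^+ (#|F| ^ l) = z.
  by elim: l {qlG ql_gt0} => [|l IH]; rewrite ?expr1 // expnS exprM expf_card.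
rewrite (big_morph (fun y : G => y ^+ (#|F| ^ l)) (id1 := 0) (op1 := +%R)).
- by apply: eq_bigr => k _; rewrite exprMn -rmorphXn fixF exprM.
- by move=> y z; rewrite exprDn_pchar.
- by rewrite expr0n eqn0Ngt ql_gt0.
Qed.

(** If [g] vanishes at 1, all codewords of [C] sum to 0, so extended words are 0 at label 0.
    Translations carry this to every coordinate: the code is zero, and so is the word of [g]. *)
Lemma extended_code_root1 g C s : cyclic_code g C ->
  affine_invariant beta (extended_code C) -> root g^G 1 -> (0 < s)%N ->
  root g^G (beta ^+ s).
Proof.
move=> cycC affE g1 s_gt0.
have c00 c : c \in extended_code C -> c 0 ord0 = 0.
  case/extended_codeP=> w wC ->.
  have /rootP := cyclic_code_root (s := 0) cycC wC g1.
  rewrite expr0 (@horner_coef_wide _ n) ?size_map_poly ?size_poly // => w1.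
  apply: (fmorph_inj iota); rewrite mxE unlift_none rmorphN rmorph_sum rmorph0.
  apply/eqP; rewrite oppr_eq0 -[X in _ == X]w1; apply/eqP/eq_bigr => i _.
  by rewrite coef_map coef_rVpoly_ord expr1n mulr1.
have [w wC wE] := cyclic_code_generator cycC.
apply/rootP; rewrite -wE -power_sum_extend //; apply: big1 => k _.
have [sg sgE] := affine_perm (lab k) (oner_neq0 G).
have := c00 _ (affE _ _ _ (oner_neq0 G) sgE _ (mem_extended_code wC)).
have -> : k = sg ord0 by apply: label_inj; rewrite sgE label0 mulr0 add0r.
by rewrite mxE => ->; rewrite rmorph0 mul0r.
Qed.

End ExtendedCyclicCodes.

(** * No power of [p ^ r] is -1 modulo [p ^ m - 1] *)

Lemma opp1_not_power (p r m l : nat) : prime p -> (0 < r)%N -> (0 < m)%N ->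
  (r %| m)%N -> (3 < p)%N \/ (2 < m)%N \/ r <> 1%N ->
  ~~ (p ^ m - 1 %| 1 + (p ^ r) ^ l)%N.
Proof.
move=> p_pr r_gt0 m_gt0 r_m hyp; have p_gt1 := prime_gt1 p_pr.
have r_le_m := dvdn_leq m_gt0 r_m.
have qk : ((p ^ r) ^ (m %/ r) = p ^ m)%N by rewrite -expnM mulnC divnK.
have k_gt0 : (0 < m %/ r)%N by rewrite divn_gt0.
have qk1 : (p ^ r) ^ (m %/ r) = 1 %[mod p ^ m - 1].
  have pmE : (p ^ m = p ^ m - 1 + 1)%N by rewrite subnK // expn_gt0 prime_gt0.
  by rewrite qk {1}pmE modnDl.
(* Reducing [l] modulo [m %/ r] bounds the power of [p ^ r] by [p ^ (m - r)]. *)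
have ql : (p ^ r) ^ l = (p ^ r) ^ (l %% (m %/ r)) %[mod p ^ m - 1].
  rewrite {1}(divn_eq l (m %/ r)) expnD [(_ * (m %/ r))%N]mulnC expnM.
  by rewrite -modnMml -[in LHS]modnXm qk1 modnXm exp1n modnMml mul1n.
rewrite /dvdn -modnDmr ql modnDmr; apply/negP => /dvdn_leq.
rewrite addn_gt0 => /(_ isT).
have e_le : (r * (l %% (m %/ r)) <= m - r)%N.
  rewrite leq_subRL // -mulnS -[leqRHS](divnK r_m) mulnC leq_mul2r.
  by rewrite ltn_pmod ?orbT.
have p2_ge4 : (4 <= p ^ 2)%N by rewrite (@leq_exp2r 2 p 2).
have u_gt0 : (0 < p ^ (m - r))%N by rewrite expn_gt0 ltnW.
have p_le : (p <= p ^ r)%N by rewrite -[leqLHS]expn1 leq_pexp2l // ltnW.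
(* With u = [p ^ (m - r)] and y = [p ^ r], divisibility would force u(y - 1) <= 2, which fails as
   soon as u or y exceeds 3. *)
have big : (3 < p ^ r)%N \/ (3 < p ^ (m - r))%N.
  case: hyp => [p_gt3|[m_gt2|r_neq1]]; first by left; apply: leq_trans p_le.
  - have [r_le1|r_gt1] := leqP r 1; last first.
      by left; apply: leq_trans p2_ge4 _; rewrite leq_pexp2l // ltnW.
    right; apply: leq_trans p2_ge4 _; rewrite leq_pexp2l ?(ltnW p_gt1) //.
    by clear -r_le1 m_gt2; lia.
  - left; apply: leq_trans p2_ge4 _; rewrite leq_pexp2l ?(ltnW p_gt1) //.
    by rewrite ltn_neqAle eq_sym r_gt0 andbT; apply/eqP.
have := leq_pexp2l (ltnW p_gt1) e_le; rewrite -expnM.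
have -> : (p ^ m = p ^ (m - r) * p ^ r)%N by rewrite -expnD subnK.
move: (p ^ (r * _))%N => e e_le_u.
have y_gt1 : (1 < p ^ r)%N := leq_trans p_gt1 p_le.
move: (p ^ (m - r))%N (p ^ r)%N u_gt0 y_gt1 big e_le_u => u y; clear; nia.
Qed.

(** * Identification of the defining set and containment of the dual *)

Theorem lemma5 (p r m : nat) (F G : finFieldType) (iota : {rmorphism F -> G})
    (beta : G) (E : {vspace 'rV[F]_(p ^ m - 1).+1}) (d : nat)
    (p_prime : prime p) (r_gt0 : (1 <= r)%N) (m_gt0 : (0 < m)%N)
    (r_dvd_m : (r %| m)%N)
    (cardF : #|F| = (p ^ r)%N) (cardG : #|G| = (p ^ m)%N)
    (beta_prim : (p ^ m - 1).-primitive_root beta)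
    (E_emai : extended_maximal_affine_invariant iota beta E)
    (E_param : code_parameters E (p ^ m) (p ^ m - 1 - m %/ r) d)
    (hyp : (3 < p)%N \/ (2 < m)%N \/ r <> 1%N) :
  (dual_code E <= E)%VS.
Proof.
have ndvd l := opp1_not_power l p_prime r_gt0 m_gt0 r_dvd_m hyp.
have pG : p \in [pchar G] := card_finPcharP cardG p_prime.
have pF : p \in [pchar F] := card_finPcharP cardF p_prime.
have qG : [pchar G].-nat #|F|.
  by rewrite cardF pnatX pnatE // pG.
have k_gt0 : (0 < m %/ r)%N by rewrite divn_gt0 // dvdn_leq.
have q_gt0 : (0 < #|F|)%N by rewrite cardF expn_gt0 prime_gt0.
clear E_param hyp.
set n := (p ^ m - 1)%N in E beta_prim E_emai ndvd *.
have pmE : (p ^ m)%N = n.+1 by rewrite /n subn1 prednK // expn_gt0 prime_gt0.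
rewrite pmE in cardG; have n_gt0 := prim_order_gt0 beta_prim.
have qk1 : #|F| ^ (m %/ r) = 1 %[mod n].
  by rewrite cardF -expnM mulnC divnK // pmE -addn1 modnDl.
have n_gt1 : (1 < n)%N.
  by rewrite ltn_neqAle n_gt0 andbT; apply: contraNneq (ndvd 0) => <-; rewrite dvd1n.
case: E_emai => C [[g cycC [j jT]] -> affE].
have Tclass (i : 'I_n) : root (map_poly iota g) (beta ^+ i) ->
    exists l, i = j * #|F| ^ l %[mod n].
  move=> iT; apply: in_cyclotomic_class_periodic k_gt0 qk1 _.
  by apply/jT; rewrite inE.
have jT' : root (map_poly iota g) (beta ^+ j).
  suff /jT : in_cyclotomic_class #|F| n j j by rewrite inE.
  by exists 0; left; rewrite muln1.
(* If 0 were in T, then T = Cl(0) = {0}; but a root at 1 forces the exponent 1 into T as well. *)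
have T0 : ~~ root (map_poly iota g) 1.
  apply/negP => g1; have [l0 l0E] := Tclass (Ordinal n_gt0) g1.
  have [l1 l1E] : exists l, j = 0 * #|F| ^ l %[mod n].
    by apply: in_cyclotomic_class_periodic k_gt0 qk1 _; exists l0; right.
  have [l2] := Tclass (Ordinal n_gt1)
    (extended_code_root1 beta_prim cardG cycC affE g1 (s := 1) isT).
  by rewrite -modnMml l1E modnMml /= !mul0n mod0n modn_small.
have [w wC wE] := cyclic_code_generator iota beta_prim cycC.
have wE' := mem_extended_code wC.
have sum0 c : c \in extended_code C -> \sum_k c 0 k = 0.
  by case/extended_codeP => u _ ->; apply: sum_extend.
have j_gt0 : (0 < j)%N.
  by rewrite lt0n; apply: contraNneq T0 => j0; rewrite j0 expr0 in jT'.
have [j1 p_j1 jE] := pfactor_coprime p_prime j_gt0.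
set a := logn p j in jE; set Q := (p ^ a)%N in jE.
have Q_gt0 : (0 < Q)%N by rewrite expn_gt0 prime_gt0.
have j1_gt0 : (0 < j1)%N by move: j_gt0; rewrite jE muln_gt0 => /andP[].
have Q_n : (Q < n)%N.
  by apply: leq_ltn_trans (ltn_ord j); rewrite jE leq_pmull.
have QT : root (map_poly iota g) (beta ^+ Q).
  apply/rootP; rewrite -wE -(power_sum_extend iota) //.
  apply: (power_sum_ppart beta_prim cardG pG (j := j1)) affE sum0 _ _ wE'.
  - by rewrite -(dvdn_pcharf pG) -prime_coprime.
  - by rewrite mulnC -jE ltnW.
  move=> c /extended_codeP[u uC ->]; rewrite mulnC -jE.
  by rewrite power_sum_extend //; apply/rootP/(cyclic_code_root beta_prim cycC uC).
have [l0 l0E] := Tclass (Ordinal Q_n) QT.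
(* Membership in a class is symmetric: [Q] lies in Cl(j), so [j] lies in Cl(Q). *)
have [l1 l1E] : exists l, j = Q * #|F| ^ l %[mod n].
  by apply: in_cyclotomic_class_periodic k_gt0 qk1 _; exists l0; right.
have TQ (i : 'I_n) : root (map_poly iota g) (beta ^+ i) ->
    exists l, i = Q * #|F| ^ l %[mod n].
  case/Tclass => l lE; exists (l1 + l)%N.
  by rewrite lE -modnMml l1E modnMml expnD mulnA.
have nQ_n : (n - Q < n)%N by rewrite ltn_subrL Q_gt0.
have w_neq0 : power_sum iota beta (extend w) (n - Q) != 0.
  rewrite power_sum_extend ?subn_gt0 // wE; apply/negP => nQT.
  have [l lE] := TQ (Ordinal nQ_n) nQT.
  (* This restates -Q = Q q^l modulo [n]; [Q] cancels, being a power of [p] and so coprime to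
     [p ^ m - 1]. *)
  suff : (n %| Q * (1 + (p ^ r) ^ l))%N.
    rewrite Gauss_dvdr; first by rewrite (negPf (ndvd l)).
    rewrite coprime_sym coprimeXl // -(coprime_pexpl _ _ m_gt0) pmE.
    exact: coprimeSn.
  rewrite mulnDr muln1 -cardF /dvdn -modnDmr -lE modnDmr /=.
  by rewrite subnKC ?modnn // ltnW.
apply/subvP => v vE; have v0 : power_sum iota beta v Q = 0.
  apply/eqP; rewrite -(mulIr_eq0 _ (mulIf w_neq0)).
  by rewrite (power_sum_dual iota beta_prim cardG affE vE wE') // Q_gt0.
apply: (mem_extended_code_power_sum beta_prim cycC T0) => [|i].
  (* Its coordinates sum to [p ^ m], which is 0 in [F]; pairing it with [v] gives the coordinate sum
     of [v]. *)
  have : const_mx 1 \in extended_code C.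
    apply: (mem_extended_code_power_sum beta_prim cycC T0) => [|i].
      under eq_bigr do rewrite mxE.
      rewrite sumr_const card_ord -pmE; apply/eqP.
      by rewrite -(dvdn_pcharf pF) dvdn_exp.
    rewrite inE => iT; apply: (power_sum_const1 iota beta_prim cardG).
    rewrite ltn_ord andbT lt0n; apply: contraNneq T0 => i0.
    by rewrite i0 expr0 in iT.
  move/mem_orthovP: vE => /[apply] vE; rewrite -[RHS]vE [RHS]edotE.
  by apply: eq_bigr => k _; rewrite mxE mulr1.
rewrite inE => iT; have [l lE] := TQ i iT.
have i_gt0 : (0 < i)%N.
  by rewrite lt0n; apply: contraNneq T0 => i0; rewrite i0 expr0 in iT.
have ql_gt0 : (0 < #|F| ^ l)%N by rewrite expn_gt0 q_gt0.
rewrite (eq_power_sum _ _ cardG _ i_gt0 _ lE) ?muln_gt0 ?Q_gt0 //.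
by rewrite power_sum_frobenius // v0 expr0n eqn0Ngt ql_gt0.
Qed.
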